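(* Let $G$ be an infinite commutative group. For every bounded function $f:G\to\mathbb{R}$ we have $$M^*(f)=\inf_{B}\ \sup_{t\in G}\,(f|B)(t),\qquad M_*(f)=\sup_{B}\ \inf_{t\in G}\,(f|B)(t),$$ where $B$ runs over all finite nonempty subsets of $G$.
   Context: $G$ is an infinite commutative (discrete) group, written additively. For a bounded function $f:G\to\mathbb{R}$, the uppermost and lowest means are $$M^*(f)=\inf_g\sup_{x\in G} g(x),\qquad M_*(f)=\sup_g\inf_{x\in G} g(x),$$ where $g$ runs over all convex combinations of translates of $f$, i.e. all functions $g(x)=\sum_{i=1}^n c_i f(x+t_i)$ with $n\ge1$, $t_i\in G$, $c_i\ge0$, $\sum c_i=1$. For a finite nonempty $B\subset G$, the $B$-average of $f$ is $(f|B)(t)=\frac1{|B|}\sum_{b\in B}f(b+t)$. *)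

(* Defs.v *)
From HB Require Import structures.
From mathcomp Require Export all_boot all_order all_algebra.
From mathcomp Require Export finmap.
From mathcomp Require Export all_classical all_reals all_analysis.
Set Implicit Arguments.
Unset Strict Implicit.
Unset Printing Implicit Defensive.
Import Order.TTheory GRing.Theory Num.Theory.
Import numFieldNormedType.Exports.
Local Open Scope classical_set_scope.
Local Open Scope ring_scope.

Definition translate_combination (R : realType) (G : zmodType) (f : G -> R)
    (n : nat) (c : 'I_n -> R) (t : 'I_n -> G) : G -> R :=
  fun x => \sum_(i < n) c i * f (x + t i).

Definition convex_translates (R : realType) (G : zmodType) (f : G -> R) :
    set (G -> R) :=
  [set g | exists (n : nat) (c : 'I_n -> R) (t : 'I_n -> G),
     [/\ (1 <= n)%N, forall i, 0 <= c i, \sum_(i < n) c i = 1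
       & g = translate_combination f c t]].

(* [sup] and [inf] are the suprema and infima of sets of reals; they have a
   junk value on sets without a bound, so the means below are meaningful
   for bounded [f] only. *)
Definition uppermost_mean (R : realType) (G : zmodType) (f : G -> R) : R :=
  inf [set sup (range g) | g in convex_translates f].

Definition lowest_mean (R : realType) (G : zmodType) (f : G -> R) : R :=
  sup [set inf (range g) | g in convex_translates f].

Definition set_average (R : realType) (G : zmodType) (f : G -> R)
    (B : {fset G}) : G -> R :=
  fun t => (#|` B|%:R)^-1 * \sum_(b <- B) f (b + t).

(* Main.v *)
(* Abelian groups satisfy Folner's condition: for translations t_1, ..., t_n
   and d > 0 some finite set B is moved by each t_i inside a set C containing B
   with |C| <= (1 + d) |B|. Averaging a convex combination g = sum_i c_i f(. + t_i)
   over B does not increase its supremum, and replacing each translate B + t_i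
   by B changes the average of f by at most 2 d sup |f|; so the average of f
   over B alone nearly does as well as g. Lowest means follow by passing to -f. *)
Require Import Defs.
From mathcomp Require Import ring lra.
Import Order.TTheory GRing.Theory Num.Theory.
Import numFieldNormedType.Exports.
Local Open Scope classical_set_scope.
Local Open Scope ring_scope.

Lemma bernoulli_inequality (R : realFieldType) (a : R) (m : nat) :
  0 <= a -> 1 + m%:R * a <= (1 + a) ^+ m.
Proof.
move=> a0; elim: m => [|m IH]; first by rewrite mul0r addr0 expr0.
rewrite exprS; apply: (@le_trans _ _ ((1 + a) * (1 + m%:R * a))).
  rewrite -subr_ge0 (_ : _ - _ = m%:R * a ^+ 2) ?mulr_ge0 ?exprn_ge0 //.
  by rewrite -natr1; ring.
by rewrite ler_wpM2l ?addr_ge0.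
Qed.

(** Exponential growth beats polynomial growth: with [k = m (n + 1)], Bernoulli bounds the power
    below by [(1 + m a) ^ (n + 1)]; [n] of these factors compete with [(k + 1) ^ n] and the spare
    one wins for large [m]. *)
Lemma exists_natrX_lt_exp (R : archiRealFieldType) (n : nat) (a : R) :
  0 < a -> exists k : nat, k.+1%:R ^+ n < (1 + a) ^+ k.
Proof.
(* This [K] gives [m (n + 1) + 1 <= (1 + m a) K] for every [m], so [m] need only satisfy
   [K ^ n < 1 + m a]. *)
move=> a0; pose K : R := 1 + n.+1%:R / a.
have K1 : 1 <= K by rewrite lerDl divr_ge0 // ltW.
pose m := Num.Def.archi_bound (K ^+ n / a).
have Km : K ^+ n < 1 + m%:R * a.
  have : K ^+ n / a < m%:R.
    apply: archi_boundP; rewrite divr_ge0 ?exprn_ge0 // ?ltW //.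
    exact: lt_le_trans ltr01 K1.
  rewrite ltr_pdivrMr // => /lt_trans; apply.
  by rewrite ltrDr.
exists (m * n.+1)%N.
have b0 : 0 < 1 + m%:R * a by rewrite ltr_pwDl // mulr_ge0 // ltW.
apply: (@lt_le_trans _ _ ((1 + m%:R * a) ^+ n.+1)); last first.
  rewrite exprM lerXn2r ?nnegrE ?bernoulli_inequality ?(ltW b0) ?(ltW a0) //.
  by rewrite exprn_ge0 // addr_ge0 // ltW.
rewrite exprSr; apply: (@le_lt_trans _ _ ((1 + m%:R * a) ^+ n * K ^+ n)).
  rewrite -exprMn lerXn2r ?nnegrE //.
    by rewrite mulr_ge0 // ?ltW // (lt_le_trans ltr01).
  rewrite -subr_ge0 (_ : _ - _ = m%:R * a + n.+1%:R / a).
    by rewrite addr_ge0 ?mulr_ge0 ?invr_ge0 // ltW.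
  by rewrite /K -[(m * n.+1).+1%:R]natr1 natrM; field; rewrite gt_eqF.
by rewrite ltr_pM2l // exprn_gt0.
Qed.

(* The boxes of all [sum_i x_i t_i] with [0 <= x_i <= k] have at most
   [(k + 1) ^ n] elements, so their cardinals cannot grow by a factor
   [1 + e] at every step. *)
Lemma folner_box (R : archiRealFieldType) (G : zmodType) (n : nat)
    (t : 'I_n -> G) (e : R) :
  0 < e -> exists B C : {fset G},
    [/\ B != fset0, (B `<=` C)%fset, forall i b, b \in B -> b + t i \in C
      & #|` C|%:R <= (1 + e) * #|` B|%:R].
Proof.
move=> e0.
pose box k : {fset G} :=
  [fset \sum_i t i *+ x i | x : {ffun 'I_n -> 'I_k.+1} in predT]%fset.
have mem_box k (x : 'I_n -> nat) :
    (forall i, (x i <= k)%N) -> \sum_i t i *+ x i \in box k.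
  move=> xk; apply/imfsetP; exists [ffun i => inord (x i)] => //=.
  by apply: eq_bigr => i _; rewrite ffunE inordK // ltnS.
have boxP k b : b \in box k -> exists2 x : 'I_n -> nat,
    forall i, (x i <= k)%N & b = \sum_i t i *+ x i.
  by case/imfsetP => x _ ->; exists (fun i => nat_of_ord (x i)) => // i; rewrite -ltnS.
have card_box k : (#|` box k| <= k.+1 ^ n)%N.
  apply: leq_trans (leq_imfset_card _ _ _) _.
  by rewrite -cardE card_ffun !card_ord.
have box0 k : 0 \in box k.
  have := @mem_box k (fun=> 0%N) (fun=> isT).
  by rewrite big1 // => i _; rewrite mulr0n.
have [k ck] : exists k, #|` box k.+1|%:R <= (1 + e) * #|` box k|%:R.
  apply: contrapT => /forallNP h.
  have grow k : (1 + e) ^+ k <= #|` box k|%:R.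
    elim: k => [|k IH]; first by rewrite expr0 ler1n (cardfsD1 0) box0.
    have /negP := h k; rewrite -ltNge => /ltW; apply: le_trans.
    by rewrite exprS ler_wpM2l // addr_ge0 // ltW.
  have [k] := exists_natrX_lt_exp R n e e0; rewrite ltNge => /negP; apply.
  by rewrite (le_trans (grow k)) // -natrX ler_nat.
exists (box k), (box k.+1); split => //.
- by apply/fset0Pn; exists 0.
- by apply/fsubsetP => b /boxP[x xk ->]; apply: mem_box => i; rewrite leqW.
- move=> i b /boxP[x xk ->].
  (* Adding [t i] raises only the [i]-th coefficient, by one, so the sum lands in the next box. *)
  rewrite [X in X \in _](_ : _ = \sum_j t j *+ (x j + (j == i))).
    by apply: mem_box => j; case: (j == i); rewrite ?addn1 ?addn0 ?ltnS // leqW.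
  under [RHS]eq_bigr do rewrite mulrnDr.
  rewrite big_split /= [X in _ = _ + X](bigD1 i) //= eqxx mulr1n.
  by rewrite [X in _ + (_ + X)]big1 ?addr0 // => j /negPf->.
Qed.

(** Only the terms over [C] minus [A] survive. This serves to compare a Folner set and its
    translates through a common superset. *)
Lemma dist_sum_fsubset (R : realDomainType) (T : choiceType) (F : T -> R)
    (M : R) (A C : {fset T}) :
  (forall x, `|F x| <= M) -> (A `<=` C)%fset ->
  `|\sum_(x <- C) F x - \sum_(x <- A) F x| <= M * (#|` C|%:R - #|` A|%:R).
Proof.
move=> FM AC; rewrite (big_fsetID _ (mem A) C) /=.
have -> : [fset x in C | x \in A]%fset = A.
  by apply/fsetP => x; rewrite !inE /= andb_idl // => /(fsubsetP AC).
have -> : [fset x in C | x \notin A]%fset = (C `\` A)%fset.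
  by apply/fsetP => x; rewrite !inE /= andbC.
rewrite addrAC subrr add0r (le_trans (ler_norm_sum _ _ _)) //.
rewrite -natrB ?fsubset_leq_card // -cardfsDS // mulr_natr.
rewrite card_fset_sum1 -sumrMnr; apply: ler_sum => x _.
by rewrite mulr1n.
Qed.

Lemma range_bound_sup (R : realType) (T : Type) (g : T -> R) (M : R) (x : T) :
  (forall x, `|g x| <= M) -> - M <= g x <= sup (range g).
Proof.
move=> gM; have := gM x; rewrite ler_norml => /andP[-> _] /=.
apply: ub_le_sup; last by exists x.
by exists M => _ [y _ <-]; have := gM y; rewrite ler_norml => /andP[].
Qed.

Lemma norm_translate_combination (R : realType) (G : zmodType) (f g : G -> R)
    (M : R) (x : G) :
  (forall x, `|f x| <= M) -> convex_translates f g -> `|g x| <= M.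
Proof.
move=> fM [n [c [t [_ c0 c1 ->]]]]; rewrite /translate_combination.
rewrite (le_trans (ler_norm_sum _ _ _)) // -[M]mul1r -c1 mulr_suml.
by apply: ler_sum => i _; rewrite normrM (ger0_norm (c0 i)) ler_wpM2l.
Qed.

(** Take equal weights and the elements of [B] as translations. This yields the easy inequality
    between the two infima. *)
Lemma set_average_convex (R : realType) (G : zmodType) (f : G -> R)
    (B : {fset G}) :
  B != fset0 -> convex_translates f (set_average f B).
Proof.
rewrite -cardfs_gt0 => B0.
exists #|` B|, (fun=> #|` B|%:R^-1), (tnth (in_tuple B)); split => //.
- by rewrite sumr_const card_ord -[_ *+ _]mulr_natr mulVf // pnatr_eq0 -lt0n.
- apply/funext => x; rewrite /set_average /translate_combination big_tnth.
  by rewrite mulr_sumr; apply: eq_bigr => i _; rewrite addrC.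
Qed.

Lemma sup_set_average_le (R : realType) (G : zmodType) (f g : G -> R)
    (M e : R) :
  (forall x, `|f x| <= M) -> convex_translates f g -> 0 < e ->
  exists2 B : {fset G}, B != fset0
    & sup (range (set_average f B)) <= sup (range g) + e.
Proof.
move=> fM gf e0; have gM x : `|g x| <= M by exact: norm_translate_combination gf.
have M0 : 0 <= M by rewrite (le_trans _ (fM 0)).
have gsup x : g x <= sup (range g) by case/andP: (range_bound_sup R G g M x gM).
case: gf gsup => n [c [t [_ c0 c1 ->]]].
set S := sup _ => gS.
(* Chosen so that [M * d <= e / 2]; the [M + 1] keeps the denominator positive when [M = 0]. *)
pose d := e / (2 * (M + 1)).
have d0 : 0 < d by rewrite divr_gt0 // mulr_gt0 // ltr_wpDl.
have [B [C [B0 BC BtC cC]]] := folner_box R G n t d d0.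
exists B => //; apply: ge_sup; first by exists (set_average f B 0); exists 0.
move=> _ [x _ <-]; rewrite /set_average.
have b0 : 0 < #|` B|%:R :> R by rewrite ltr0n cardfs_gt0.
rewrite mulrC ler_pdivrMr //.
have MCB : M * (#|` C|%:R - #|` B|%:R) <= e / 2 * #|` B|%:R.
  have h : #|` C|%:R - #|` B|%:R <= d * #|` B|%:R.
    by rewrite lerBlDr -{2}[#|` B|%:R]mul1r -mulrDl addrC.
  apply: (le_trans (ler_wpM2l M0 h)); rewrite mulrA ler_wpM2r ?(ltW b0) //.
  have M1 : 0 < M + 1 by rewrite ltr_wpDl.
  rewrite (_ : M * d = e / 2 * (M / (M + 1))); last by rewrite /d; field; rewrite gt_eqF.
  by rewrite ler_piMr ?divr_ge0 ?(ltW e0) // ler_pdivrMr // mul1r lerDl.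
(* [B] and [B + t i] have the same cardinal and both lie in [C], so each sum is within [e / 2 * |B|]
   of the sum over [C]. *)
have step i :
    \sum_(b <- B) f (b + x) <= \sum_(b <- B) f (b + x + t i) + e * #|` B|%:R.
  pose F y := f (y + x).
  have FM y : `|F y| <= M by exact: fM.
  pose Bi : {fset G} := [fset (b + t i)%R | b in B]%fset.
  have BiC : (Bi `<=` C)%fset by apply/fsubsetP => _ /imfsetP[b /= bB ->]; exact: BtC.
  have inj : injective (fun b : G => b + t i) by exact: addIr.
  have cBi : #|` Bi| = #|` B| by rewrite card_imfset.
  have sBi : \sum_(b <- Bi) F b = \sum_(b <- B) f (b + x + t i).
    rewrite big_imfset /=; last by move=> ? ? _ _; exact: inj.
    by apply: eq_bigr => b _; rewrite /F addrAC.
  have := le_trans (dist_sum_fsubset R G F M B C FM BC) MCB.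
  have := dist_sum_fsubset R G F M Bi C FM BiC; rewrite cBi sBi => /le_trans /(_ MCB).
  rewrite !ler_norml => /andP[_ h1] /andP[h2 _].
  rewrite -/(F _) (eq_bigr F) //; move: h1 h2; lra.
rewrite -[X in X <= _]mul1r -c1 mulr_suml.
apply: (@le_trans _ _ (\sum_(i < n) c i *
   (\sum_(b <- B) f (b + x + t i) + e * #|` B|%:R))).
  by apply: ler_sum => i _; rewrite ler_wpM2l.
(* After exchanging the sums, the inner sum over [i] is the convex combination at [b + x], hence at
   most [S]. *)
under eq_bigr do rewrite mulrDr mulr_sumr.
rewrite big_split /= -mulr_suml c1 mul1r exchange_big /= mulrDl lerD2r.
rewrite mulr_natr card_fset_sum1 -sumrMnr; apply: ler_sum => b _.
by rewrite mulr1n; exact: gS.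
Qed.

Lemma uppermost_mean_set_average (R : realType) (G : zmodType) (f : G -> R)
    (M : R) :
  (forall x, `|f x| <= M) ->
  uppermost_mean f =
    inf [set sup (range (set_average f B)) | B in [set B : {fset G} | B != fset0]].
Proof.
(* The common lower bound [- M], with the nonempty [B = {0}] below, keeps both infima from taking
   their default value. *)
move=> fM; have supM g : convex_translates f g -> - M <= sup (range g).
  move=> gf; have gM x : `|g x| <= M by exact: norm_translate_combination gf.
  by have /andP[] := range_bound_sup R G g M 0 gM; exact: le_trans.
have B1 : [fset (0 : G)]%fset != fset0 by apply/fset0Pn; exists 0; rewrite inE.
apply: le_anti; apply/andP; split.
- apply: lb_le_inf; first by eexists; exists [fset 0]%fset.
  move=> _ [B B0 <-]; apply: ge_inf.
    by exists (- M) => _ [g gf <-]; exact: supM.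
  by exists (set_average f B) => //; exact: set_average_convex.
- apply: lb_le_inf.
    by eexists; exists (set_average f [fset 0]%fset) => //; exact: set_average_convex.
  move=> _ [g gf <-]; apply/ler_addgt0Pr => e e0.
  have [B B0] := sup_set_average_le R G f g M e fM gf e0; apply: le_trans.
  apply: ge_inf; last by exists B.
  by exists (- M) => _ [D D0 <-]; apply: supM; exact: set_average_convex.
Qed.

(** [inf] is by definition the negated [sup] of the negated set, so the identity covers default
    values too. *)
Lemma inf_range_opp (R : realType) (T : Type) (g : T -> R) :
  inf (range g) = - sup (range (fun x => - g x)).
Proof. by rewrite /inf image_comp. Qed.

Lemma sup_inf_range_opp (R : realType) (T I : Type) (D : set I)
    (g : I -> T -> R) :
  sup [set inf (range (g i)) | i in D] =
  - inf [set sup (range (fun x => - g i x)) | i in D].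
Proof.
rewrite /inf opprK image_comp; congr sup.
by apply: eq_imagel => i _; rewrite /= -inf_range_opp.
Qed.

(** Negation is an involution carrying the convex combinations of translates of [f] onto those of
    [- f], with the same weights and translations. *)
Lemma lowest_mean_opp (R : realType) (G : zmodType) (f : G -> R) :
  lowest_mean f = - uppermost_mean (fun x => - f x).
Proof.
rewrite /lowest_mean (sup_inf_range_opp R G _ _ id); congr (- inf _).
have oppc (h g : G -> R) : convex_translates h g ->
    convex_translates (fun x => - h x) (fun x => - g x).
  move=> [n [c [t [n0 c0 c1 ->]]]]; exists n, c, t; split => //.
  apply/funext => x; rewrite /translate_combination -sumrN.
  by apply: eq_bigr => i _; rewrite mulrN.
have oppK (h : G -> R) : (fun x => - - h x) = h by apply/funext => x; rewrite opprK.
apply/seteqP; split => _ [g gf <-].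
  by exists (fun x => - g x) => //; exact: oppc.
exists (fun x => - g x); last by rewrite oppK.
by rewrite -[f]oppK; exact: oppc gf.
Qed.

Lemma set_averageN (R : realType) (G : zmodType) (f : G -> R) (B : {fset G}) :
  set_average (fun x => - f x) B = fun x => - set_average f B x.
Proof. by apply/funext => x; rewrite /set_average sumrN mulrN. Qed.

Theorem theorem6p4 (R : realType) (G : zmodType)
  (G_infinite : infinite_set [set: G])
  (f : G -> R) (f_bounded : bounded_fun f) :
  uppermost_mean f =
    inf [set sup (range (set_average f B)) | B in [set B : {fset G} | B != fset0]]
  /\
  lowest_mean f =
    sup [set inf (range (set_average f B)) | B in [set B : {fset G} | B != fset0]].
Proof.
have [M fM] : exists M, forall x, `|f x| <= M.
  (* [bounded_fun] provides a bound by each real strictly above some [M], whence [M + 1]. *)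
  case: f_bounded => M [_ /(_ (M + 1))].
  by rewrite ltrDl ltr01 => /(_ isT) fM; exists (M + 1) => x; exact: fM.
split; first exact: uppermost_mean_set_average fM.
rewrite lowest_mean_opp sup_inf_range_opp.
rewrite (@uppermost_mean_set_average _ _ _ M); last by move=> x; rewrite normrN.
by congr (- inf _); apply: eq_imagel => B _; rewrite set_averageN.
Qed.
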